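(* Let $G\subset\mathbb R^N$ be a convex set with nonempty interior. Suppose that $G$ is either open or closed and that its boundary $\partial G$ is differentiable. For each $\mathbf u_*\in\partial G$ let $\mathbf n_*$ (depending only on $\mathbf u_*$) denote an inward-pointing normal vector of $\partial G$ at $\mathbf u_*$. Then $G=G_*$, where $$G_*=\Big\{\mathbf u\in\mathbb R^N:\ (\mathbf u-\mathbf u_* )\cdot\mathbf n_*\succ 0\quad\forall\,\mathbf u_*\in\partial G\Big\},$$ and the symbol ''$\succ$'' is taken as ''$>$'' if $G$ is open, and as ''$\ge$'' if $G$ is closed.
   Context: ''$\cdot$'' is the Euclidean inner product. Differentiability of $\partial G$ means that $\partial G$ is a smooth hypersurface having a tangent hyperplane at every boundary point; a normal vector is a nonzero vector orthogonal to this tangent hyperplane, and it is inward-pointing if it points towards $G$. The paper phrases the conclusion as ''$G_*$ is the GQL representation of $G$'', meaning that $G=G_*$ and $G_*$ is described only by constraints affine in $\mathbf u$. *)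

(* Defs.v *)
From HB Require Import structures.
From mathcomp Require Import all_boot all_order all_algebra.
From mathcomp Require Import all_classical all_reals all_analysis.
Import Order.TTheory GRing.Theory Num.Theory.
Import numFieldNormedType.Exports.

Set Implicit Arguments.
Unset Strict Implicit.
Unset Printing Implicit Defensive.

Local Open Scope classical_set_scope.
Local Open Scope ring_scope.

(* The library norm of 'rV[R]_N is the max norm. It is used only for topology
   and differentiability, where it agrees with the Euclidean norm. *)

Definition dotp (R : realType) (N : nat) (u v : 'rV[R]_N) : R :=
  \sum_(i < N) u 0 i * v 0 i.

Definition boundary (T : topologicalType) (A : set T) : set T :=
  closure A `\` interior A.

(* Near each of its points, S is a regular level set of a differentiable
   function. Continuity of the derivative is not required, so C^1 and C^infty
   hypersurfaces are included. The condition is vacuous for S = set0. *)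
Definition differentiable_hypersurface (R : realType) (N : nat)
    (S : set 'rV[R]_N) : Prop :=
  forall x, S x -> exists (U : set 'rV[R]_N) (phi : 'rV[R]_N -> R),
    [/\ open_nbhs x U,
        forall y, U y -> differentiable phi y,
        forall y, U y -> S y -> exists v, 'd phi y v != 0
      & S `&` U = [set y | U y /\ phi y = 0]].

(* Velocities at x of curves drawn on S. On a hypersurface as above they form
   the tangent hyperplane (as a linear subspace), namely the kernel of 'd phi x
   for any local defining function phi. *)
Definition tangent_space (R : realType) (N : nat)
    (S : set 'rV[R]_N) (x : 'rV[R]_N) : set 'rV[R]_N :=
  [set v | exists gamma : R -> 'rV[R]_N,
    [/\ gamma 0 = x,
        \forall t \near (0 : R), S (gamma t)
      & is_derive (0 : R) (1 : R) gamma v]].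

Definition normal_vector (R : realType) (N : nat)
    (S : set 'rV[R]_N) (x n : 'rV[R]_N) : Prop :=
  n != 0 /\ forall v, tangent_space S x v -> dotp n v = 0.

Definition inward_normal (R : realType) (N : nat)
    (G : set 'rV[R]_N) (x n : 'rV[R]_N) : Prop :=
  normal_vector (boundary G) x n /\
  \forall t \near (0 : R)^'+, G (x + t *: n).

(* Main.v *)
Require Import Defs.
From HB Require Import structures.
From mathcomp Require Import all_boot all_order all_algebra.
From mathcomp Require Import all_classical all_reals all_analysis.
From mathcomp Require Import ring.
Import Order.TTheory GRing.Theory Num.Theory.
Import numFieldNormedType.Exports.

Set Implicit Arguments.
Unset Strict Implicit.
Unset Printing Implicit Defensive.

Local Open Scope classical_set_scope.
Local Open Scope ring_scope.

(** The theorem holds because every boundary point carries a supporting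
    hyperplane and, the boundary being differentiable, this hyperplane is the
    tangent one, with the given inward normal as its normal.

    Support is obtained without a separation theorem. Fix x on the boundary and
    a normal vector n at x. The boundary is locally the zero set of a function
    phi with nonzero differential at x. A displacement v in the kernel of that
    differential is the velocity of a curve on the boundary: by the intermediate
    value theorem phi vanishes at some x + t (v + r w) with r small, and a
    selection r(t) tending to 0 gives the curve; continuity of phi near x and
    differentiability at x suffice ([level_set_tangent_curve],
    [small_selection]). Hence the tangent space contains a full hyperplane, and
    since n is nonzero and orthogonal to it, any vector orthogonal to n is
    tangent ([orthogonal_normal_tangent]).

    If u is interior to the convex set G, all points of the segment from u to x
    other than x are interior, and so they are after a slight displacement of u
    ([convex_interior_segment]). A curve leaving x with velocity u - x would
    then enter the interior, so u - x is not tangent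
    ([tangent_avoids_interior]) and (u - x) . n is nonzero. It cannot be
    negative: n points into G, so a point of G lies on the positive side, and
    the segment joining it to u would meet the tangent hyperplane at an
    interior point. Thus (u - x) . n > 0 on the interior of G
    ([interior_above_tangent]).

    Conversely, a segment from an interior point a to a point u outside G meets
    the boundary at some x ([segment_boundary]). The affine function
    (. - x) . n(x) is positive at a and vanishes at x, so it is nonpositive at
    u, and negative when x differs from u, as it does when G is closed. *)

(** * The Euclidean inner product *)

Lemma dotpDl (R : realType) (N : nat) (u v w : 'rV[R]_N) :
  dotp (u + v) w = dotp u w + dotp v w.
Proof. by rewrite -big_split; apply: eq_bigr => i _; rewrite mxE mulrDl. Qed.

Lemma dotpZl (R : realType) (N : nat) (a : R) (u w : 'rV[R]_N) :
  dotp (a *: u) w = a * dotp u w.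
Proof. by rewrite mulr_sumr; apply: eq_bigr => i _; rewrite mxE mulrA. Qed.

Lemma dotpBl (R : realType) (N : nat) (u v w : 'rV[R]_N) :
  dotp (u - v) w = dotp u w - dotp v w.
Proof. by rewrite -scaleN1r dotpDl dotpZl mulN1r. Qed.

Lemma dotpC (R : realType) (N : nat) (u v : 'rV[R]_N) : dotp u v = dotp v u.
Proof. by apply: eq_bigr => i _; rewrite mulrC. Qed.

Lemma dotp_gt0 (R : realType) (N : nat) (u : 'rV[R]_N) : u != 0 -> 0 < dotp u u.
Proof.
move=> u0; rewrite lt_def sumr_ge0 ?andbT; last first.
  by move=> i _; rewrite -expr2 sqr_ge0.
apply: contra u0; rewrite psumr_eq0; last by move=> i _; rewrite -expr2 sqr_ge0.
move=> /allP u0; apply/eqP/rowP => i; rewrite mxE.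
by have := u0 i (mem_index_enum i); rewrite /= mulf_eq0 orbb => /eqP.
Qed.

(** * Segments from an interior point of a convex set *)

Lemma convex_set_segment (R : realType) (V : lmodType R)
    (G : set V) (a b : V) (t : R) :
  convex_set G -> G a -> G b -> 0 <= t -> t <= 1 -> G (b + t *: (a - b)).
Proof.
move=> cG Ga Gb t0 t1.
have := cG a b (Itv01 t0 t1); rewrite !inE => /(_ Ga Gb).
suff -> : b + t *: (a - b) = t *: a + (1 - t) *: b by [].
by rewrite scalerBr scalerBl scale1r addrCA.
Qed.

Lemma convex_interior_segment (R : realType) (V : normedModType R)
    (G : set V) (a b : V) (t : R) :
  convex_set G -> interior G a -> closure G b -> 0 < t -> t <= 1 ->
  interior G (b + t *: (a - b)).
Proof.
move=> cG Ga Gb t0 t1; set z := b + _.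
have tN0 : t != 0 by rewrite gt_eqF.
(* h y z' is the point from which the homothety of centre y and ratio t reaches
   z'; as h b z = a is interior, h y z' stays in G when b is moved to a point y
   of G and z' ranges near z. *)
pose h (y z' : V) := y + t^-1 *: (z' - y).
have hbz : h b z = a.
  by rewrite /h /z addrAC subrr add0r scalerA mulVf// scale1r addrC subrK.
have [y [Gy Ghy]] : G `&` [set y | interior G (h y z)] !=set0.
  apply: Gb; have : h ^~ z @ b --> h b z.
    apply: cvgD; first exact: cvg_id.
    by apply: cvgZl_tmp; apply: cvgB; [exact: cvg_cst|exact: cvg_id].
  move=> /(_ (interior G)); apply; rewrite hbz; exact: nbhs_interior.
rewrite /interior/=; have : h y @ z --> h y z.
  apply: cvgD; first exact: cvg_cst.
  by apply: cvgZl_tmp; apply: cvgB; [exact: cvg_id|exact: cvg_cst].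
move=> /(_ _ Ghy) Gh.
apply: (@filterS _ (nbhs z) _ (h y @^-1` G)) => // z' /= Gz.
suff -> : z' = y + t *: (h y z' - y).
  by apply: convex_set_segment => //; exact: ltW.
by rewrite /h addrAC subrr add0r scalerA divff// scale1r addrC subrK.
Qed.

(** The boundary is met at the last parameter s, that is, the supremum of those
    whose point lies in G: it is a limit of points of G, and if its point were
    interior, slightly larger parameters would qualify too. *)
Lemma segment_boundary (R : realType) (V : normedModType R)
    (G : set V) (a b : V) :
  interior G a -> ~ G b ->
  exists2 s : R, 0 < s <= 1 & boundary G (a + s *: (b - a)).
Proof.
move=> Ga Gb; pose p (t : R) := a + t *: (b - a).
have p0 : p 0 = a by rewrite /p scale0r addr0.
have p1 : p 1 = b by rewrite /p scale1r addrC subrK.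
have pc s : p @ s --> p s.
  by apply: cvgD; [exact: cvg_cst|apply: cvgZr_tmp; exact: cvg_id].
pose E := [set t : R | 0 <= t <= 1 /\ G (p t)].
have E0 : E 0 by split; [rewrite lexx ler01|rewrite p0; exact: interior_subset].
have ubE : ubound E 1 by move=> t [/andP[]].
have hE : has_ubound E by exists 1.
pose s := sup E.
have s0 : 0 <= s by exact: ub_le_sup.
have s1 : s <= 1 by apply: ge_sup => //; exists 0.
have clGs : closure G (p s).
  move=> B /(pc s) pB; have [t [[_ Gt] Bt]] : E `&` (p @^-1` B) !=set0.
    by apply: closure_sup pB => //; exists 0.
  by exists (p t).
have nGs : ~ interior G (p s).
  move=> /(pc s) Gs; have sN1 : s != 1.
    by apply/eqP => s1E; apply: Gb; rewrite -p1 -s1E; exact: nbhs_singleton Gs.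
  have slt1 : s < 1 by rewrite lt_neqAle sN1.
  have sE : \forall t \near s^'+, E t /\ s < t.
    near=> t; have st : s < t by near: t; exact: nbhs_right_gt.
    split => //; split.
      rewrite (le_trans s0 (ltW st))/= ltW//; near: t; exact: nbhs_right_lt.
    by near: t; exact: (cvg_at_right_filter (@cvg_id _ _) Gs).
  have [t [Et]] := @filter_ex _ _ (at_right_proper_filter s) _ sE.
  by rewrite ltNge => /negP; apply; exact: ub_le_sup.
exists s; last by split.
rewrite s1 andbT lt_neqAle s0 andbT; apply/eqP => s0E; apply: nGs.
by rewrite -s0E p0.
Unshelve. all: by end_near.
Qed.

(** * Curves on a regular level set *)

(** Turns arbitrarily small solutions r of P t r, found for each tolerance e on
    a neighbourhood that depends on e, into a single solution function tending
    to 0. Choosing for each t a solution of almost least modulus achieves every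
    tolerance at once. *)
Lemma small_selection (R : realType) (P : R -> R -> Prop) :
  (forall e, 0 < e -> \forall t \near (0 : R)^', exists2 r, `|r| <= e & P t r) ->
  exists2 r : R -> R, r t @[t --> 0^'] --> (0 : R) &
    \forall t \near (0 : R)^', P t (r t).
Proof.
move=> HP; pose A t := [set `|r| | r in P t].
have lbA t : has_lbound (A t) by exists 0 => _ [r _ <-].
(* The infimum of the admissible |r| need not be attained; the slack |t| makes
   a near-minimizer available and still vanishes in the limit. *)
pose Q t := [set r | P t r /\ `|r| < inf (A t) + `|t|].
pose r t := xget 0 (Q t).
have rP t : t != 0 -> (exists r, P t r) -> Q t (r t).
  move=> tN0 [r0 Pr0]; apply: (@xgetPex _ 0 (Q t)).
  have [||_ [r1 Pr1 <-] lt1] := @inf_adherent R (A t) `|t|.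
  - by rewrite normr_gt0.
  - by split => //; exists `|r0|; exists r0.
  by exists r1.
exists r; last first.
  near=> t; have [] // := rP t; first by near: t; exact: nbhs_dnbhs_neq.
  have [r0 _ Pr0] : exists2 r, `|r| <= 1 & P t r by near: t; exact: HP.
  by exists r0.
apply/cvgr0Pnorm_lt => e e0; near=> t.
have [r0 r0e Pr0] : exists2 r, `|r| <= e / 2 & P t r.
  by near: t; apply: HP; rewrite divr_gt0.
have [||_ rt] := rP t; [by near: t; exact: nbhs_dnbhs_neq|by exists r0|].
apply: (lt_le_trans rt); rewrite (splitr e) lerD//.
  by apply: le_trans r0e; apply: ge_inf => //; exists r0.
by apply/ltW; near: t; apply: dnbhs0_lt; rewrite divr_gt0.
Unshelve. all: by end_near.
Qed.

(** For small t, the function phi takes values of opposite signs at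
    x + t (v - e w) and x + t (v + e w), since its derivatives at x in the
    directions v - e w and v + e w are - e and e; it vanishes in between. This
    replaces the implicit function theorem, which would need a continuous
    differential. *)
Lemma level_set_tangent_curve (R : realType) (V : normedModType R)
    (U : set V) (phi : V -> R) (x v w : V) :
  open_nbhs x U -> (forall y, U y -> {for y, continuous phi}) ->
  phi x = 0 -> differentiable phi x -> 'd phi x v = 0 -> 'd phi x w = 1 ->
  exists2 r : R -> R, r t @[t --> 0^'] --> (0 : R) &
    \forall t \near (0 : R)^',
      U (x + t *: (v + r t *: w)) /\ phi (x + t *: (v + r t *: w)) = 0.
Proof.
move=> oU cphi phix dphi dv dw.
pose P t r := U (x + t *: (v + r *: w)) /\ phi (x + t *: (v + r *: w)) = 0.
apply: (@small_selection R P) => e e0.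
have Ue : \forall t \near (0 : R)^', forall r, `|r| <= e ->
    U (x + t *: (v + r *: w)).
  have /nbhs_ballP[d /= d0 dU] := open_nbhs_nbhs oU.
  pose M := `|v| + e * `|w| + 1.
  have M0 : 0 < M by rewrite ltr_wpDl// addr_ge0// mulr_ge0// ltW.
  near=> t => r re; apply: dU; rewrite -ball_normE/= opprD addrA subrr add0r.
  rewrite normrN normrZ; have tM : `|t| < d / M.
    by near: t; apply: dnbhs0_lt; rewrite divr_gt0.
  rewrite ltr_pdivlMr// in tM; apply: le_lt_trans tM.
  rewrite ler_wpM2l// (le_trans (ler_normD _ _))// /M -addrA lerD2l normrZ.
  by rewrite (@le_trans _ _ (e * `|w|)) ?lerDl// ler_wpM2r.
(* Along v + a w the derivative of phi at x is a, whatever its sign. *)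
have dq (a : R) : t^-1 * phi (x + t *: (v + a *: w)) @[t --> 0^'] --> a.
  have := @diff_derivable _ _ _ _ _ (v + a *: w) dphi.
  rewrite /derivable => /cvg_toP -/(_ _ erefl).
  rewrite -/(derive phi x (v + a *: w)) deriveE// linearD linearZ/= dv dw.
  rewrite add0r [_ *: 1]mulr1; apply: cvg_trans; apply: near_eq_cvg; near=> t.
  by rewrite /= phix subr0 [t *: _ + x]addrC.
near=> t; have tN0 : t != 0 by near: t; exact: nbhs_dnbhs_neq.
have Ut r : `|r| <= e -> U (x + t *: (v + r *: w)) by move: r; near: t.
have gp : 0 < t^-1 * phi (x + t *: (v + e *: w)).
  by near: t; exact: (cvgr_gt e (dq e)).
have gn : t^-1 * phi (x + t *: (v + (- e) *: w)) < 0.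
  by near: t; apply: (cvgr_lt (- e) (dq (- e))); rewrite oppr_lt0.
pose g r := t^-1 * phi (x + t *: (v + r *: w)).
have [|||r rI gr] := @IVT R g (- e) e 0.
- by rewrite ge0_cp// ltW.
- apply: continuous_in_subspaceT => r; rewrite inE/= in_itv/= -ler_norml => re.
  have lc : x + t *: (v + s *: w) @[s --> r] --> x + t *: (v + r *: w).
    apply: cvgD; first exact: cvg_cst.
    apply: cvgZl_tmp; apply: cvgD; first exact: cvg_cst.
    by apply: cvgZr_tmp; exact: cvg_id.
  apply: cvgM; first exact: cvg_cst.
  by apply: (cvg_comp _ _ lc); apply: cphi; exact: Ut.
- by rewrite ge_min le_max (ltW gn) (ltW gp) orbT.
have re : `|r| <= e by move: rI; rewrite in_itv/= -ler_norml.
exists r => //; split; first exact: Ut.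
by move/eqP: gr; rewrite mulf_eq0 invr_eq0 (negbTE tN0) => /eqP.
Unshelve. all: by end_near.
Qed.

(** The curve x + t (v + r(t) w) has velocity v at t = 0 because r(t) tends
    to 0. *)
Lemma level_set_tangent_space (R : realType) (N : nat) (S U : set 'rV[R]_N)
    (phi : 'rV[R]_N -> R) (x v w : 'rV[R]_N) :
  open_nbhs x U -> (forall y, U y -> differentiable phi y) ->
  S `&` U = [set y | U y /\ phi y = 0] -> S x ->
  'd phi x w != 0 -> 'd phi x v = 0 -> tangent_space S x v.
Proof.
move=> oU dphi SU Sx dw dv; have [_ Ux] := oU.
have phix : phi x = 0.
  by have [] : [set y | U y /\ phi y = 0] x by rewrite -SU.
have [||r r0 Ur] := @level_set_tangent_curve R _ U phi x v
    (('d phi x w)^-1 *: w) oU _ phix (dphi _ Ux) dv.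
- by move=> y Uy; exact: differentiable_continuous (dphi _ Uy).
- by rewrite linearZ/= [_ *: _]mulVf.
pose gamma t := x + t *: (v + r t *: (('d phi x w)^-1 *: w)).
have gamma0 : gamma 0 = x by rewrite /gamma scale0r addr0.
exists gamma; split => //.
  rewrite /prop_near1 dnbhsE; split; last first.
    by apply/principal_filterP; rewrite gamma0.
  apply: filterS Ur => t [Ut gt].
  by have [] : (S `&` U) (gamma t) by rewrite SU.
have D : h^-1 *: ((gamma \o shift 0) (h *: 1) - gamma 0) @[h --> 0^'] --> v.
  rewrite gamma0.
  have : v + r h *: (('d phi x w)^-1 *: w) @[h --> 0^'] -->
      v + 0 *: (('d phi x w)^-1 *: w).
    by apply: cvgD; [exact: cvg_cst|exact: cvgZr_tmp].
  rewrite scale0r addr0.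
  apply: cvg_trans; apply: near_eq_cvg; near=> h.
  rewrite /= addr0 [h *: 1]mulr1 /gamma addrAC subrr add0r.
  rewrite [RHS]scalerA mulVf ?scale1r//.
  by near: h; exact: nbhs_dnbhs_neq.
split; first by apply/cvg_ex; exists v.
exact: cvg_lim D.
Unshelve. all: by end_near.
Qed.

(** The kernel of the differential of a local defining function is a hyperplane
    of tangent vectors, all orthogonal to n. As n is nonzero, its orthogonal
    complement is no larger than this hyperplane, so it is made of tangent
    vectors. *)
Lemma orthogonal_normal_tangent (R : realType) (N : nat) (S : set 'rV[R]_N)
    (x n v : 'rV[R]_N) :
  differentiable_hypersurface S -> S x -> normal_vector S x n ->
  dotp v n = 0 -> tangent_space S x v.
Proof.
move=> hS Sx [n0 nT] vn; have [U [phi [oU dphi dN0 SU]]] := hS x Sx.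
have [w dw] := dN0 x oU.2 Sx.
have kerT z : 'd phi x z = 0 -> tangent_space S x z.
  exact: level_set_tangent_space oU dphi SU Sx dw.
apply: (kerT v); pose c := 'd phi x v / 'd phi x w.
have : dotp n (v - c *: w) = 0.
  by apply/nT/kerT; rewrite linearB linearZ/= [_ *: _]divfK ?subrr.
rewrite dotpC dotpBl dotpZl vn sub0r => /eqP; rewrite oppr_eq0 mulf_eq0.
case/orP=> [|/eqP wn].
  by rewrite mulf_eq0 invr_eq0 (negbTE dw) orbF => /eqP.
(* Otherwise n is orthogonal to w as well as to the kernel, hence to itself. *)
have := dotp_gt0 n0; pose d := 'd phi x n / 'd phi x w.
have : dotp n (n - d *: w) = 0.
  by apply/nT/kerT; rewrite linearB linearZ/= [_ *: _]divfK ?subrr.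
by rewrite dotpC dotpBl dotpZl wn mulr0 subr0 => ->; rewrite ltxx.
Qed.

(** * The tangent hyperplane supports the convex set *)

(** Given a boundary curve gamma with velocity u - x at x, the points
    x + (gamma h - x) / h tend to u, hence are interior for small h > 0; then
    gamma h, lying between x and such a point, is interior as well. *)
Lemma tangent_avoids_interior (R : realType) (N : nat) (G : set 'rV[R]_N)
    (x u : 'rV[R]_N) :
  convex_set G -> boundary G x -> tangent_space (boundary G) x (u - x) ->
  ~ interior G u.
Proof.
move=> cG [clx _] [gamma [gamma0 Sgamma [gammaD gammaE]]] Gu.
have gl : x + h^-1 *: (gamma h - x) @[h --> (0 : R)^'] --> u.
  rewrite -[u in X in _ --> X](subrKC x u); apply: cvgD; first exact: cvg_cst.
  rewrite -gammaE; apply: cvg_trans gammaD; apply: near_eq_cvg; near=> h.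
  by rewrite /= addr0 [h *: 1]mulr1 gamma0.
have Gg : \forall h \near (0 : R)^'+, interior G (gamma h).
  near=> h; have h0 : 0 < h by near: h; exact: nbhs_right_gt.
  have -> : gamma h = x + h *: ((x + h^-1 *: (gamma h - x)) - x).
    by rewrite [_ - x]addrAC subrr add0r scalerA divff ?gt_eqF// scale1r subrKC.
  apply: convex_interior_segment => //.
    by near: h; have := cvg_dnbhs_at_right gl => /(_ _ (nbhs_interior Gu)).
  by near: h; apply: nbhs_right_le.
have Sg : \forall h \near (0 : R)^'+, boundary G (gamma h).
  exact: (cvg_at_right_filter (@cvg_id _ (nbhs (0 : R))) Sgamma).
by have [h [Gh [_]]] :=
  @filter_ex _ _ (at_right_proper_filter 0) _ (filterI Gg Sg).
Unshelve. all: by end_near.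
Qed.

(** The segment from b to a crosses the hyperplane at a point other than b, and
    all its points other than b are interior. *)
Lemma opposite_sides_interior (R : realType) (N : nat) (G : set 'rV[R]_N)
    (a b x n : 'rV[R]_N) :
  convex_set G -> interior G a -> G b ->
  dotp (a - x) n * dotp (b - x) n < 0 ->
  exists2 z, interior G z & dotp (z - x) n = 0.
Proof.
move=> cG Ga Gb; set p := dotp (a - x) n; set q := dotp (b - x) n => pq.
have q0 : q != 0 by apply: contraTneq pq => ->; rewrite mulr0 ltxx.
have qq : 0 < q ^+ 2 by rewrite exprn_even_gt0.
have d0 : 0 < q ^+ 2 - p * q by rewrite subr_gt0 (lt_trans pq).
(* The crossing parameter q / (q - p), multiplied through by q so that the
   denominator is positive on either side. *)
exists (b + (q ^+ 2 / (q ^+ 2 - p * q)) *: (a - b)).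
  apply: convex_interior_segment => //; first exact: subset_closure.
    by rewrite divr_gt0.
  by rewrite ler_pdivrMr// mul1r lerDl oppr_ge0 ltW.
have -> : b + (q ^+ 2 / (q ^+ 2 - p * q)) *: (a - b) - x =
    (b - x) + (q ^+ 2 / (q ^+ 2 - p * q)) *: ((a - x) - (b - x)).
  by apply/rowP => i; rewrite !mxE; ring.
rewrite dotpDl dotpZl [dotp (a - x - _) n]dotpBl -/p -/q; field.
by rewrite gt_eqF.
Qed.

(** An interior point is never on the tangent hyperplane at x; if one were below
    it, the segment joining it to x + t n in G would cross the hyperplane at
    another interior point. *)
Lemma interior_above_tangent (R : realType) (N : nat) (G : set 'rV[R]_N)
    (x n u : 'rV[R]_N) :
  convex_set G -> differentiable_hypersurface (boundary G) -> boundary G x ->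
  inward_normal G x n -> interior G u -> 0 < dotp (u - x) n.
Proof.
move=> cG hG Gx [nx inw] Gu.
have offT z : interior G z -> dotp (z - x) n != 0.
  move=> Gz; apply/eqP => /(orthogonal_normal_tangent hG Gx nx) T.
  exact: tangent_avoids_interior cG Gx T Gz.
rewrite lt_neqAle eq_sym offT//= leNgt; apply/negP => un.
have [t [t0 Gt]] := @filter_ex _ _ (at_right_proper_filter (0 : R)) _
  (filterI (nbhs_right_gt 0) inw).
have [|z Gz zn] := opposite_sides_interior (x := x) (n := n) cG Gu Gt.
  rewrite nmulr_rlt0// addrAC subrr add0r dotpZl mulr_gt0//.
  by apply: dotp_gt0; case: nx.
by have := offT z Gz; rewrite zn eqxx.
Qed.

Theorem theorem3p9 (R : realType) (N : nat) (G : set 'rV[R]_N)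
    (n : 'rV[R]_N -> 'rV[R]_N) :
  convex_set G ->
  interior G !=set0 ->
  open G \/ closed G ->
  differentiable_hypersurface (boundary G) ->
  (forall us : 'rV[R]_N, boundary G us -> inward_normal G us (n us)) ->
  (open G ->
     G = [set u : 'rV[R]_N | forall us : 'rV[R]_N,
           boundary G us -> dotp (u - us) (n us) > 0]) /\
  (closed G ->
     G = [set u : 'rV[R]_N | forall us : 'rV[R]_N,
           boundary G us -> dotp (u - us) (n us) >= 0]).
Proof.
move=> cG [a Ga] _ hG nG.
have above x u : boundary G x -> interior G u -> 0 < dotp (u - x) (n x).
  by move=> Gx; apply: interior_above_tangent => //; exact: nG.
(* A point x on the segment from a to u splits it in the ratio s : 1 - s, so
   any affine function vanishing at x has values at a and u in proportion
   - s : 1 - s. *)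
have cross u : ~ G u -> exists s x, [/\ 0 < s <= 1, x = a + s *: (u - a),
    boundary G x & s * dotp (u - x) (n x) = (s - 1) * dotp (a - x) (n x)].
  move=> Gu; have [s s01 Gx] := segment_boundary Ga Gu.
  exists s, (a + s *: (u - a)); split => //; rewrite -!dotpZl; congr dotp.
  by apply/rowP => i; rewrite !mxE; ring.
split=> [oG|clG]; apply/seteqP; split=> u /=.
- by move=> Gu x Gx; apply: above => //; rewrite ((interior_id G).1 oG).
- move=> Hu; apply: contrapT => /cross[s [x [/andP[s0 s1] _ Gx e]]].
  have := mulr_gt0 s0 (Hu _ Gx); rewrite e ltNge mulr_le0_ge0// ?subr_le0//.
  exact/ltW/above.
- move=> Gu x Gx; rewrite leNgt; apply/negP => un.
  have [|z Gz zn] := opposite_sides_interior (x := x) (n := n x) cG Ga Gu.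
    by rewrite pmulr_rlt0// above.
  by have := above x z Gx Gz; rewrite zn ltxx.
- move=> Hu; apply: contrapT => Gu.
  have [s [x [/andP[s0 s1] xE Gx e]]] := cross _ Gu.
  have := mulr_ge0 (ltW s0) (Hu _ Gx).
  rewrite e leNgt nmulr_rlt0 ?above// subr_lt0 lt_neqAle s1 andbT.
  (* At s = 1 the boundary point would be u itself, which a closed G
     contains. *)
  apply/eqP => s1E; apply: Gu; move: Gx.1; rewrite xE s1E scale1r subrKC.
  by move: clG => /closure_id <-.
Qed.
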